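(* The variance of the `number of jumps' statistic $J$ among all full binary trees with $n$ internal vertices (each such tree being equally likely) is $$ \frac{n^{2}-1}{8 n -4}. $$
   Context: A full binary tree is an unlabeled ordered tree defined recursively: it is either the single-vertex tree, denoted $\cdot$, or a pair $T=[T_L,T_R]$ where $T_L$ (left subtree) and $T_R$ (right subtree) are full binary trees. The number of internal vertices $V(T)$ is defined by $V(\cdot)=0$, $V([T_L,T_R])=V(T_L)+V(T_R)+1$. The number of jumps $J(T)$ is defined by $J(\cdot)=0$ and $J([T_L,T_R])=J(T_R)$ if $T_L=\cdot$, while $J([T_L,T_R])=J(T_L)+J(T_R)+1$ if $T_L\neq \cdot$.
   Formalization: The formula is stated for n ≥ 1 only: for n = 0 there is a single full binary tree, so the variance is 0, whereas the formula would give 1/4. *)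

(* Defs.v *)
From HB Require Import structures.
From mathcomp Require Import all_boot all_order all_algebra.

Set Implicit Arguments.
Unset Strict Implicit.
Unset Printing Implicit Defensive.

Import GRing.Theory.

Inductive fbtree : Type := Leaf | Node of fbtree & fbtree.

Fixpoint fbtree_encode (t : fbtree) : GenTree.tree unit :=
  match t with
  | Leaf => GenTree.Leaf tt
  | Node l r => GenTree.Node 0 [:: fbtree_encode l; fbtree_encode r]
  end.

Fixpoint fbtree_decode (g : GenTree.tree unit) : option fbtree :=
  match g with
  | GenTree.Leaf _ => Some Leaf
  | GenTree.Node _ [:: g1; g2] =>
      if fbtree_decode g1 is Some l then
        if fbtree_decode g2 is Some r then Some (Node l r) else None
      else None
  | _ => None
  end.

Lemma fbtree_encodeK : pcancel fbtree_encode fbtree_decode.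
Proof. by elim=> //= l -> r ->. Qed.

HB.instance Definition _ := Countable.copy fbtree (pcan_type fbtree_encodeK).

Fixpoint internal_vertices (t : fbtree) : nat :=
  match t with
  | Leaf => 0
  | Node l r => internal_vertices l + internal_vertices r + 1
  end.

Fixpoint jumps (t : fbtree) : nat :=
  match t with
  | Leaf => 0
  | Node Leaf r => jumps r
  | Node l r => jumps l + jumps r + 1
  end.

Record fbtree_of (n : nat) : Type := FbtreeOf {
  tree_of :> fbtree;
  _ : internal_vertices tree_of == n
}.

HB.instance Definition _ n := [isSub for @tree_of n].
HB.instance Definition _ n := [Countable of fbtree_of n by <:].

(* All trees of height at most k; these include every tree with at most k
   internal vertices, which is what makes [fbtree_of n] a finite type. *)
Fixpoint fbtrees_height (k : nat) : seq fbtree :=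
  if k is k'.+1 then
    Leaf :: [seq Node l r | l <- fbtrees_height k', r <- fbtrees_height k']
  else [:: Leaf].

Lemma mem_fbtrees_height k t :
  internal_vertices t <= k -> t \in fbtrees_height k.
Proof.
elim: k t => [|k IHk] [|l r] //=; rewrite addn1 // ltnS => le_lr_k.
rewrite inE; apply/orP; right; apply/allpairsP; exists (l, r); split=> //=.
  by apply: IHk; apply: leq_trans le_lr_k; apply: leq_addr.
by apply: IHk; apply: leq_trans le_lr_k; apply: leq_addl.
Qed.

Definition fbtree_of_enum (n : nat) : seq (fbtree_of n) :=
  pmap insub (undup (fbtrees_height n)).

Lemma fbtree_of_enum_uniq n : uniq (fbtree_of_enum n).
Proof. exact: pmap_sub_uniq (undup_uniq _). Qed.

Lemma mem_fbtree_of_enum n (t : fbtree_of n) : t \in fbtree_of_enum n.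
Proof.
rewrite mem_pmap_sub mem_undup; apply: mem_fbtrees_height.
by rewrite (eqP (valP t)).
Qed.

HB.instance Definition _ n :=
  isFinite.Build (fbtree_of n)
    (Finite.uniq_enumP (@fbtree_of_enum_uniq n) (@mem_fbtree_of_enum n)).

Local Open Scope ring_scope.

(* Expectation and variance under the uniform distribution on [T]. *)
Definition uniform_mean (T : finType) (X : T -> rat) : rat :=
  (\sum_(t : T) X t) / #|T|%:R.

Definition uniform_variance (T : finType) (X : T -> rat) : rat :=
  uniform_mean (fun t => (X t - uniform_mean X) ^+ 2).

(* Main.v *)
(** Let D be the number of non-leaf left children minus the number of non-leaf
    right children, so that D = 2 J - (n - 1).  Splitting trees at the root, and
    exchanging the two subtrees, D has mean 0, hence the sum V_n of D^2 satisfies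
    V_(n+1) = 2 sum_i V_i C_(n-i) + 2 C_n for n > 0, where C_n is the number of
    trees.  This is solved by V_n = 2 (n - 1) C_(n-1), because the Catalan
    convolution is symmetric.  The variance of J is V_n / (4 C_n), and
    (n + 1) C_n = 2 (2 n - 1) C_(n-1). *)
Require Import Defs.
From mathcomp Require Import all_boot all_order all_algebra.
From mathcomp Require Import ring lra zify.

Import Order.TTheory GRing.Theory Num.Theory.

Local Open Scope ring_scope.

Definition tree_sum (f : fbtree -> rat) (n : nat) : rat :=
  \sum_(t : fbtree_of n) f t.

Definition catalan (n : nat) : rat := tree_sum (fun=> 1) n.

(** This is the statistic D. Testing for a leaf through [internal_vertices] makes the contribution
    of the root constant once the sizes of the two subtrees are fixed. *)
Fixpoint skew (t : fbtree) : rat :=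
  if t is Node l r then
    skew l + skew r
      + (0 < internal_vertices l)%N%:R - (0 < internal_vertices r)%N%:R
  else 0.

Lemma fbtrees_height_uniq k : uniq (fbtrees_height k).
Proof.
elim: k => //= k IHk; apply/andP; split.
  by apply/allpairsP => -[[l r]] /= [].
by apply: allpairs_uniq => // -[l r] [l' r'] _ _ /= [-> ->].
Qed.

(** Any bound [k] is allowed, so that subtrees of different sizes can be summed over one common
    list. *)
Lemma tree_sum_height k n f : (n <= k)%N ->
  tree_sum f n =
  \sum_(t <- fbtrees_height k | internal_vertices t == n) f t.
Proof.
move=> le_nk; rewrite /tree_sum.
rewrite -(big_map (@tree_of n) xpredT f) -[RHS]big_filter.
apply: perm_big; apply: uniq_perm.
- by rewrite map_inj_uniq ?index_enum_uniq //; exact: val_inj.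
- by rewrite filter_uniq ?fbtrees_height_uniq.
move=> t; rewrite mem_filter; apply/mapP/andP => [[u _ ->]|[tn _]].
  split; first exact: (valP u).
  by apply: mem_fbtrees_height; rewrite (eqP (valP u)).
by exists (FbtreeOf tn) => //; rewrite mem_index_enum.
Qed.

Lemma eq_tree_sum n f g :
  (forall t, internal_vertices t = n -> f t = g t) ->
  tree_sum f n = tree_sum g n.
Proof. by move=> fg; apply: eq_bigr => t _; apply: fg; apply/eqP/(valP t). Qed.

Lemma tree_sum0 f : tree_sum f 0 = f Leaf.
Proof. by rewrite (@tree_sum_height 0) //= big_cons big_nil /= addr0. Qed.

Lemma tree_sumS f n :
  tree_sum f n.+1 =
  \sum_(i < n.+1) tree_sum (fun l => tree_sum (fun r => f (Node l r)) (n - i)) i.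
Proof.
rewrite (@tree_sum_height n.+1) //= big_cons /= big_mkcond big_allpairs_dep /=.
have -> : \sum_(i < n.+1)
      tree_sum (fun l => tree_sum (fun r => f (Node l r)) (n - i)) i =
    \sum_(i < n.+1) \sum_(l <- fbtrees_height n)
      if internal_vertices l == i then
        \sum_(r <- fbtrees_height n | internal_vertices r == (n - i)%N)
          f (Node l r)
      else 0.
  apply: eq_bigr => i _; rewrite (@tree_sum_height n) ?leq_ord // big_mkcond.
  by apply: eq_bigr => l _; rewrite (@tree_sum_height n) ?leq_subr.
rewrite [RHS]exchange_big /=; apply: eq_bigr => l _.
rewrite -!big_mkcond /=.
(* For a fixed left subtree, only the index [i] equal to its size contributes; if it has more than
   [n] internal vertices, both sides are empty. *)
have [le_ln|lt_nl] := leqP (internal_vertices l) n.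
  rewrite (big_pred1 (Ordinal (le_ln : internal_vertices l < n.+1)%N)) /=.
    by apply: eq_bigl => r; apply/eqP/eqP; lia.
  by move=> i; rewrite /= eq_sym -val_eqE.
rewrite !big_pred0 // => [i|r]; apply/eqP; last by lia.
by have := ltn_ord i; lia.
Qed.

Lemma tree_sumD f g n :
  tree_sum (fun t => f t + g t) n = tree_sum f n + tree_sum g n.
Proof. exact: big_split. Qed.

Lemma tree_sumZ a f n : tree_sum (fun t => a * f t) n = a * tree_sum f n.
Proof. by rewrite /tree_sum mulr_sumr. Qed.

Lemma tree_sum_const a n : tree_sum (fun=> a) n = a * catalan n.
Proof. by rewrite -tree_sumZ; apply: eq_tree_sum => t _; rewrite mulr1. Qed.

Lemma catalanE n : catalan n = #|{: fbtree_of n}|%:R.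
Proof. by rewrite /catalan /tree_sum sumr_const. Qed.

Lemma catalan0 : catalan 0 = 1.
Proof. exact: tree_sum0. Qed.

Lemma catalanS n :
  catalan n.+1 = \sum_(i < n.+1) catalan i * catalan (n - i).
Proof.
rewrite /catalan tree_sumS; apply: eq_bigr => i _.
by rewrite tree_sum_const mulrC.
Qed.

Lemma convC (a b : nat -> rat) n :
  \sum_(i < n.+1) a i * b (n - i)%N = \sum_(i < n.+1) b i * a (n - i)%N.
Proof.
rewrite (reindex_inj rev_ord_inj); apply: eq_bigr => i _ /=.
by rewrite subSS subKn ?leq_ord // mulrC.
Qed.

(** Averaging the sum with its reversal replaces the weight i by (i + (n - i)) / 2 = n / 2. *)
Lemma sum_index_catalan n :
  \sum_(i < n.+1) i%:R * catalan i * catalan (n - i) =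
  n%:R / 2 * catalan n.+1.
Proof.
set S := LHS.
suff: S + S = n%:R * catalan n.+1 by lra.
rewrite {2}/S (convC (fun i => i%:R * catalan i)) /S -big_split /= catalanS.
rewrite mulr_sumr; apply: eq_bigr => i _.
by rewrite natrB ?leq_ord //; ring.
Qed.

(* The defect [e n] of the claimed identity satisfies [e 0 = 0] and
   [e n.+1 = 2 \sum_i e i * C (n - i)], so it vanishes. *)
Lemma catalan_rec n :
  n.+2%:R * catalan n.+1 = (4 * n%:R + 2) * catalan n.
Proof.
pose e k := k.+2%:R * catalan k.+1 - (4 * k%:R + 2) * catalan k.
suff: e n = 0 by move/eqP; rewrite subr_eq0 => /eqP.
elim/ltn_ind: n => -[_|n IHn].
  by rewrite /e catalanS big_ord1 /= catalan0; lra.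
suff ->: e n.+1 = 2 * \sum_(i < n.+1) e i * catalan (n - i).
  by rewrite big1 ?mulr0 // => i _; rewrite IHn ?mul0r.
(* These are the terms of positive index of the convolution of (i + 1) C_i with C at n + 1; the
   subtracted [catalan n.+1] is its term at i = 0. *)
have shifted : \sum_(i < n.+1) i.+2%:R * catalan i.+1 * catalan (n - i) =
    (n.+1%:R / 2 + 1) * catalan n.+2 - catalan n.+1.
  rewrite mulrDl -sum_index_catalan mul1r catalanS -big_split /=.
  rewrite [X in _ = X - _]big_ord_recl /= catalan0 subn0 !mul0r mul1r add0r.
  rewrite addrAC subrr add0r; apply: eq_bigr => i _.
  by rewrite /bump /= add1n subSS; ring.
have ->: \sum_(i < n.+1) e i * catalan (n - i) =
    \sum_(i < n.+1) i.+2%:R * catalan i.+1 * catalan (n - i)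
    - 4 * (\sum_(i < n.+1) i%:R * catalan i * catalan (n - i))
    - 2 * catalan n.+1.
  rewrite catalanS !mulr_sumr -!sumrB; apply: eq_bigr => i _.
  by rewrite /e; ring.
by rewrite shifted sum_index_catalan /e; field.
Qed.

Lemma tree_sum_skew n : tree_sum skew n = 0.
Proof.
elim/ltn_ind: n => -[_|n IHn]; first exact: tree_sum0.
rewrite tree_sumS.
(* By induction only the root contributes, and its two terms are the convolutions of [nonleaf] with
   [catalan] in either order, which cancel. *)
pose nonleaf i : rat := (0 < i)%N%:R * catalan i.
under eq_bigr => i _.
  rewrite (@eq_tree_sum _ _ (fun l => catalan (n - i) * skew l
    + ((0 < i)%N%:R - (0 < n - i)%N%:R) * catalan (n - i))); last first.
    move=> l li /=.
    rewrite (@eq_tree_sum _ _ (fun r => skew r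
      + (skew l + (0 < i)%N%:R - (0 < n - i)%N%:R))).
      by rewrite tree_sumD tree_sum_const IHn ?ltnS ?leq_subr //; ring.
    by move=> r ri; rewrite li ri; ring.
  rewrite tree_sumD tree_sumZ tree_sum_const IHn // mulr0 add0r.
  have ->: ((0 < i)%N%:R - (0 < n - i)%N%:R) * catalan (n - i) * catalan i =
     nonleaf i * catalan (n - i) - catalan i * nonleaf (n - i)%N.
    by rewrite /nonleaf; ring.
  over.
by rewrite sumrB (convC nonleaf) subrr.
Qed.

(** In the square of [skew l + skew r + d], every term linear in a skew sums to zero, and the two
    squared skews give equal convolutions by symmetry. *)
Lemma tree_sum_skew_sqS n :
  tree_sum (fun t => skew t ^+ 2) n.+1 =
  2 * (\sum_(i < n.+1) tree_sum (fun t => skew t ^+ 2) i * catalan (n - i))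
  + \sum_(i < n.+1) ((0 < i)%N%:R - (0 < n - i)%N%:R) ^+ 2
      * catalan i * catalan (n - i).
Proof.
pose V i := tree_sum (fun t => skew t ^+ 2) i.
rewrite mulr_natl mulr2n {2}(convC V) -!big_split tree_sumS /=.
apply: eq_bigr => i _.
pose d : rat := (0 < i)%N%:R - (0 < n - i)%N%:R.
rewrite (@eq_tree_sum _ _ (fun l => catalan (n - i) * skew l ^+ 2
  + (2 * d * catalan (n - i) * skew l
     + (V (n - i)%N + d ^+ 2 * catalan (n - i))))).
  rewrite !tree_sumD !tree_sumZ !tree_sum_const tree_sum_skew -/(V i) -/d.
  by ring.
move=> l li /=.
rewrite (@eq_tree_sum _ _ (fun r => skew r ^+ 2
  + (2 * (skew l + d) * skew r + (skew l + d) ^+ 2))).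
  by rewrite !tree_sumD tree_sumZ tree_sum_const tree_sum_skew -/(V _); ring.
by move=> r ri; rewrite li ri /d; ring.
Qed.

Lemma tree_sum_skew_sq n :
  tree_sum (fun t => skew t ^+ 2) n.+1 = 2 * n%:R * catalan n.
Proof.
elim/ltn_ind: n => -[_|n IHn].
  by rewrite tree_sum_skew_sqS !big_ord1 /= tree_sum0 /=; ring.
rewrite tree_sum_skew_sqS big_ord_recl tree_sum0 /= expr0n mul0r add0r.
under eq_bigr => i _.
  rewrite /bump /= add1n subSS IHn ?ltn_ord //.
  rewrite -[2 * _ * _]mulrA -mulrA.
  over.
rewrite -mulr_sumr.
(* The root term survives only at the two extreme indices, where exactly one subtree is a leaf; each
   of them gives [catalan n.+1]. *)
rewrite sum_index_catalan [X in _ + X]big_ord_recl big_ord_recr /=.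
rewrite big1 => [|i _]; last first.
  by rewrite /bump /= add1n subSS subn_gt0 ltn_ord subrr expr0n /= !mul0r.
by rewrite /bump /= add1n subnn subn0 ltnn catalan0 mulr0n; field.
Qed.

(** Each of the n internal vertices other than the root is a left or a right child, and [jumps]
    counts the left ones, so D = J - (n - J). *)
Lemma skewE n t : internal_vertices t = n.+1 ->
  skew t = 2 * (jumps t)%:R - n%:R.
Proof.
elim: t n => // l IHl r IHr n /=; rewrite addn1 => -[<-].
case: l IHl => [_|ll lr IHl]; case: r IHr => [_|rl rr IHr].
- by rewrite /=; ring.
- have vr : internal_vertices (Node rl rr) =
      (internal_vertices rl + internal_vertices rr).+1 by rewrite /= addn1.
  by rewrite (IHr _ vr) vr; rewrite /=; ring.
- have vl : internal_vertices (Node ll lr) =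
      (internal_vertices ll + internal_vertices lr).+1 by rewrite /= addn1.
  by rewrite (IHl _ vl) vl; move: (jumps (Node ll lr)) => j; rewrite /=; ring.
have vl : internal_vertices (Node ll lr) =
    (internal_vertices ll + internal_vertices lr).+1 by rewrite /= addn1.
have vr : internal_vertices (Node rl rr) =
    (internal_vertices rl + internal_vertices rr).+1 by rewrite /= addn1.
rewrite (IHl _ vl) (IHr _ vr) vl vr.
by move: (jumps (Node ll lr)) (jumps (Node rl rr)) => j k; rewrite /=; ring.
Qed.

Lemma catalan_gt0 n : 0 < catalan n.
Proof.
elim: n => [|n IHn]; first by rewrite catalan0.
have: 0 < (4 * n%:R + 2) * catalan n.
  by rewrite mulr_gt0 // ltr_wpDl // mulr_ge0 // ler0n.
by rewrite -catalan_rec pmulr_rgt0 // ltr0n.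
Qed.

Theorem theorem7p2 (n : nat) (hn : (0 < n)%N) :
  uniform_variance (fun t : fbtree_of n => (jumps t)%:R : rat) =
  (n%:R ^+ 2 - 1) / (8 * n%:R - 4).
Proof.
(* With n + 1 internal vertices the claimed value becomes n (n + 2) / (8 n + 4). *)
case: n hn => // n _.
have C_neq0 : catalan n.+1 != 0 by rewrite gt_eqF ?catalan_gt0.
have jumpsE t : internal_vertices t = n.+1 ->
    (jumps t)%:R = 2^-1 * skew t + n%:R / 2 :> rat.
  by move=> /skewE ->; field.
have mean : uniform_mean (fun t : fbtree_of n.+1 => (jumps t)%:R) = n%:R / 2.
  rewrite /uniform_mean -catalanE.
  rewrite -[\sum_(t : fbtree_of n.+1) _]/(tree_sum (fun t => (jumps t)%:R) n.+1).
  rewrite (eq_tree_sum _ _ _ jumpsE) tree_sumD tree_sumZ tree_sum_const tree_sum_skew.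
  by rewrite mulr0 add0r mulfK.
rewrite /uniform_variance mean /uniform_mean -catalanE.
rewrite -[\sum_(t : fbtree_of n.+1) _]/
  (tree_sum (fun t => ((jumps t)%:R - n%:R / 2) ^+ 2) n.+1).
rewrite (@eq_tree_sum _ _ (fun t => 4^-1 * skew t ^+ 2)); last first.
  by move=> t /jumpsE ->; field.
rewrite tree_sumZ tree_sum_skew_sq.
have n_ge0 : 0 <= n%:R :> rat by rewrite ler0n.
have d_neq0 : 4 * n%:R + 2 != 0 :> rat by rewrite gt_eqF //; lra.
(* This expresses the second moment as a multiple of the number of trees, which then cancels. *)
have ->: catalan n = n.+2%:R * catalan n.+1 / (4 * n%:R + 2).
  by rewrite catalan_rec mulrAC mulfV // mul1r.
field; rewrite C_neq0 d_neq0 !andbT gt_eqF //; lra.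
Qed.
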